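(* Let $\mathcal X$ be finite and let $\hat P_0,\hat P_1$ be distributions on $\mathcal X$ with full support. For a threshold $\hat\gamma$ with $-D(\hat P_0\|\hat P_1)\le\hat\gamma\le D(\hat P_1\|\hat P_0)$ let $\hat{\mathcal Q}_0=\{Q:D(Q\|\hat P_0)-D(Q\|\hat P_1)\ge\hat\gamma\}$, $\hat{\mathcal Q}_1=\{Q:D(Q\|\hat P_0)-D(Q\|\hat P_1)\le\hat\gamma\}$, and for $r_0,r_1\ge0$ define the worst-case error exponents of the mismatched likelihood ratio test $$\underline{\hat E}_0(r_0)=\min_{P_0\in\mathcal B(\hat P_0,r_0)}\min_{Q\in\hat{\mathcal Q}_0}D(Q\|P_0),\qquad \underline{\hat E}_1(r_1)=\min_{P_1\in\mathcal B(\hat P_1,r_1)}\min_{Q\in\hat{\mathcal Q}_1}D(Q\|P_1).$$ Let $\hat Q_\lambda(x)=\hat P_0^{1-\lambda}(x)\hat P_1^{\lambda}(x)/\sum_a\hat P_0^{1-\lambda}(a)\hat P_1^{\lambda}(a)$ with $\lambda\in[0,1]$ solving $D(\hat Q_\lambda\|\hat P_0)-D(\hat Q_\lambda\|\hat P_1)=\hat\gamma$, and let $E_0=D(\hat Q_\lambda\|\hat P_0)$, $E_1=D(\hat Q_\lambda\|\hat P_1)$ (the matched exponents). Then for $i\in\{0,1\}$, as $r_i\to0$, $$\underline{\hat E}_i(r_i)=E_i-\sqrt{r_i\,\theta_i(\hat P_0,\hat P_1,\hat\gamma)}+o(\sqrt{r_i}),\qquad \theta_i(\hat P_0,\hat P_1,\hat\gamma)=\frac{2}{\alpha}\mathrm{Var}_{\hat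 P_i}\Big(\frac{\hat Q_\lambda(X)}{\hat P_i(X)}\Big).$$
   Context: $D$ is relative entropy. The divergence ball is $\mathcal B(Q,r)=\{P\in\mathcal P(\mathcal X):d(Q,P)\le r\}$ where either (i) $d(Q,P)=D_\alpha(Q\|P)=\frac{1}{\alpha-1}\log\sum_x Q(x)^\alpha P(x)^{1-\alpha}$ is the Rényi divergence of order $\alpha>0$ ($\alpha=1$ meaning relative entropy), or (ii) $d(Q,P)=D_f(Q\|P)=\sum_xP(x)f(Q(x)/P(x))$ is an $f$-divergence with $f$ convex and twice differentiable, in which case $\alpha:=f''(1)$. The mismatched likelihood ratio test with test distributions $\hat P_0,\hat P_1$ decides hypothesis 1 iff $D(\hat T\|\hat P_0)-D(\hat T\|\hat P_1)\ge\hat\gamma$ for observation type $\hat T$, while observations are generated i.i.d. by the true $P_0$ or $P_1$; the inner minima above are its error exponents under true distribution $P_i$. *)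

(* Defs.v *)
From HB Require Import structures.
From mathcomp Require Import all_boot all_order all_algebra.
From mathcomp Require Import all_classical all_reals all_analysis.
Set Implicit Arguments. Unset Strict Implicit. Unset Printing Implicit Defensive.
Import Order.TTheory GRing.Theory Num.Theory.
Local Open Scope ring_scope.
Local Open Scope classical_set_scope.

Section Defs.
Variables (R : realType) (X : finType).

Definition is_dist (P : X -> R) : Prop :=
  (forall x, 0 <= P x) /\ \sum_(x : X) P x = 1.

Definition full_support (P : X -> R) : Prop := forall x, 0 < P x.

Definition abs_cont (Q P : X -> R) : bool := [forall x, (P x == 0) ==> (Q x == 0)].

(* the finite sum defining D(Q||P) (0 log 0 = 0); meaningful when Q << P *)
Definition relent (Q P : X -> R) : R :=
  \sum_(x : X) (if Q x == 0 then 0 else Q x * ln (Q x / P x)).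

Definition KL (Q P : X -> R) : \bar R :=
  if abs_cont Q P then (relent Q P)%:E else +oo%E.

Definition renyi (a : R) (Q P : X -> R) : \bar R :=
  if a == 1 then KL Q P
  else if (1 < a) && ~~ abs_cont Q P then +oo%E
  else let s := \sum_(x : X) (Q x `^ a * P x `^ (1 - a)) in
       if s == 0 then +oo%E else ((a - 1)^-1 * ln s)%:E.

(* f'(oo) = lim_{t -> oo} f(t)/t, written (for convex f) as the supremum of
   the nondecreasing chord slopes (f t - f 1)/(t - 1), t > 1 *)
Definition fslope_infty (f : R -> R) : \bar R :=
  ereal_sup [set ((f t - f 1) / (t - 1))%:E | t in [set t : R | 1 < t]].

(* f-divergence D_f(Q||P) = sum_x P(x) f(Q(x)/P(x)), with the usual
   conventions 0 f(0/0) = 0 and 0 f(a/0) = a f'(oo) *)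
Definition fdiv (f : R -> R) (Q P : X -> R) : \bar R :=
  \sum_(x : X) (if P x == 0%R then (if Q x == 0%R then 0%E
                                     else ((Q x)%:E * fslope_infty f)%E)
                else (P x * f (Q x / P x))%:E).

Definition admissible_div (d : (X -> R) -> (X -> R) -> \bar R) (alpha : R) : Prop :=
  (0 < alpha /\ d = renyi alpha)
  \/ (exists f : R -> R,
        (forall x y t, 0 < x -> 0 < y -> 0 <= t <= 1 ->
           f (t * x + (1 - t) * y) <= t * f x + (1 - t) * f y)
        /\ (forall x, 0 < x -> derivable f x 1 /\ derivable f^`() x 1)
        /\ f 1 = 0
        /\ alpha = f^`(2) 1 /\ 0 < alpha
        /\ d = fdiv f).

Definition div_ball (d : (X -> R) -> (X -> R) -> \bar R) (Q : X -> R) (r : R)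
  : set (X -> R) := [set P | is_dist P /\ (d Q P <= r%:E)%E].

(* log-likelihood statistic D(Q||P0) - D(Q||P1) (P0, P1 full support) *)
Definition llr (P0 P1 Q : X -> R) : R := relent Q P0 - relent Q P1.

Definition Qset0 (P0 P1 : X -> R) (g : R) : set (X -> R) :=
  [set Q | is_dist Q /\ g <= llr P0 P1 Q].
Definition Qset1 (P0 P1 : X -> R) (g : R) : set (X -> R) :=
  [set Q | is_dist Q /\ llr P0 P1 Q <= g].

Definition worst_exp (d : (X -> R) -> (X -> R) -> \bar R) (Ph : X -> R)
  (A : set (X -> R)) (r : R) : \bar R :=
  ereal_inf [set ereal_inf [set KL Q P | Q in A] | P in div_ball d Ph r].

Definition tilt (P0 P1 : X -> R) (l : R) (x : X) : R :=
  P0 x `^ (1 - l) * P1 x `^ l / \sum_(a : X) (P0 a `^ (1 - l) * P1 a `^ l).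

Definition var_under (P g : X -> R) : R :=
  \sum_(x : X) P x * g x ^+ 2 - (\sum_(x : X) P x * g x) ^+ 2.

Definition sqrt_expansion (F : R -> \bar R) (E theta : R) : Prop :=
  forall eps : R, 0 < eps -> exists delta : R, 0 < delta /\
    forall r : R, 0 < r < delta ->
      ((E - Num.sqrt (r * theta) - eps * Num.sqrt r)%:E <= F r)%E /\
      (F r <= (E - Num.sqrt (r * theta) + eps * Num.sqrt r)%:E)%E.

End Defs.

(* Main.v *)
(* Write P for the true distribution, u = Qhat_lambda / Phat_0 and V = Var(u) under Phat_0.

   Lower bound: on the half-space Qset0, tilting gives (Gibbs' inequality)
   D(Q||P) >= E_0 - ln (sum P u) >= E_0 - sum (P - Phat_0)(u - 1), and by Cauchy-Schwarz
   the last sum is at most sqrt (chi2 * V), where chi2 = sum (P - Phat_0)^2 / Phat_0.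
   Upper bound: test with Q = Qhat_lambda and P = Phat_0 (1 + c (u - 1)), c of order sqrt r.

   Both bounds only use that d is, near Phat_0, (alpha / 2) chi2 to leading order, together
   with the fact that a small ball is close to Phat_0 in the chi2 sense. For f-divergences
   the linear term of f at 1 integrates to zero, Taylor's theorem controls likelihood ratios
   close to 1, and convexity makes ratios far from 1 (including P x = 0) too expensive.
   A Renyi divergence is a function of the f-divergence with
   f t = (t^alpha - 1 - alpha (t - 1)) / (alpha (alpha - 1)).
   Hypothesis 1 follows by exchanging the two test distributions and lambda with 1 - lambda. *)
Require Import Defs.
From HB Require Import structures.
From mathcomp Require Import all_boot all_order all_algebra.
From mathcomp Require Import all_classical all_reals all_analysis.
From mathcomp Require Import ring lra.
Import Order.TTheory GRing.Theory Num.Theory.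
Local Open Scope ring_scope.

(** * Second-order behaviour of convex functions at 1 *)

Section Calculus.
Import numFieldNormedType.Exports.
Local Open Scope classical_set_scope.
Local Open Scope ring_scope.
Context {R : realType}.
Implicit Types (f k : R -> R) (a t x y : R).

Definition convex_pos f : Prop := forall x y t, 0 < x -> 0 < y -> 0 <= t <= 1 ->
  f (t * x + (1 - t) * y) <= t * f x + (1 - t) * f y.

(** Second-order Peano expansion at 1 with vanishing value and slope; the linear term of a generator
    is removed before this is used. *)
Definition quadratic_at1 k a : Prop := forall e, 0 < e ->
  exists d, [/\ 0 < d, d < 1 & forall t, `|t - 1| <= d ->
    `|k t - a / 2 * (t - 1) ^+ 2| <= e * (t - 1) ^+ 2].

Lemma is_derive_approx f x a : is_derive x 1 f a -> forall e, 0 < e ->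
  exists2 d, 0 < d & forall y, `|y - x| < d ->
    `|f y - f x - a * (y - x)| <= e * `|y - x|.
Proof.
move=> [df dfa] e e0.
have /cvgrPdist_le/(_ e e0) : (h^-1 *: ((f \o shift x) (h *: (1:R)) - f x)) @[h --> 0^'] --> a.
  by rewrite -dfa; exact: df.
move=> -[d /= d0 H]; exists d => // y yd.
have [->|yx] := eqVneq y x; first by rewrite !subrr mulr0 subr0 normr0 mulr0.
have yx0 : y - x != 0 by rewrite subr_eq0.
have := H (y - x); rewrite /= sub0r normrN => /(_ yd yx0).
rewrite /= /shift /= scaler1 subrK.
have -> : f y - f x - a * (y - x) = - ((a - (y - x)^-1 * (f y - f x)) * (y - x)).
  by field.
by rewrite normrN normrM; apply: ler_wpM2r.
Qed.

Lemma MVT_pos f f1 x y : (forall x, 0 < x -> is_derive x 1 f (f1 x)) ->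
  0 < x -> 0 < y -> exists c, [/\ 0 < c, `|c - x| <= `|y - x|,
    (x <= y -> x <= c) , (y <= x -> c <= x) & f y - f x = f1 c * (y - x)].
Proof.
move=> df.
have cf (u v : R) : 0 < u -> {within `[u, v]%classic, continuous f}.
  move=> u0; apply: derivable_within_continuous => z.
  by rewrite in_itv /= => /andP[uz _]; case: (df z (lt_le_trans u0 uz)).
move=> x0 y0; have [xy|yx] := leP x y.
  have [||| c] := @MVT_segment _ f f1 x y.
  - by [].
  - by move=> z; rewrite in_itv /= => /andP[xz _]; apply: df; apply: lt_trans xz.
  - exact: cf.
  rewrite in_itv /= => /andP[xc cy] E; exists c; split => //.
  - exact: lt_le_trans xc.
  - by rewrite !ger0_norm ?subr_ge0 // lerD2r.
  - by move=> yx; apply: le_trans yx.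
have [||| c] := @MVT_segment _ f f1 y x.
- exact: ltW.
- by move=> z; rewrite in_itv /= => /andP[xz _]; apply: df; apply: lt_trans xz.
- exact: cf.
rewrite in_itv /= => /andP[xc cy] E; exists c; split => //.
- exact: lt_le_trans xc.
- by rewrite !ler0_norm; lra.
- by lra.
Qed.

(** As [f1] is assumed differentiable only at 1, the mean value theorem is applied once, to the
    remainder [F]: its derivative is at most e |x - 1| near 1, and the intermediate point is no
    farther from 1 than t. *)
Lemma quadratic_at1_derive f f1 a : (forall x, 0 < x -> is_derive x 1 f (f1 x)) ->
  is_derive (1 : R) 1 f1 a ->
  quadratic_at1 (fun t => f t - f 1 - f1 1 * (t - 1)) a.
Proof.
move=> df df1 e e0; have [d d0 H] := is_derive_approx _ _ _ df1 e e0.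
exists (Num.min (d / 2) (1 / 2)).
split; [by rewrite lt_min; apply/andP; split; lra| |].
  by rewrite gt_min; apply/orP; right; lra.
move=> t; rewrite le_min => /andP[td t1].
have t0 : 0 < t by move: t1; rewrite ler_norml; lra.
pose F (t : R) := f t - f 1 - f1 1 * (t - 1) - a / 2 * (t - 1) ^+ 2.
have dF x : 0 < x -> is_derive x 1 F (f1 x - f1 1 - a * (x - 1)).
  move=> x0; have dfx := df x x0; rewrite /F.
  apply: is_derive_eq; rewrite /GRing.scale /=; lra.
have [c [c0 ct _ _]] := MVT_pos F _ 1 t dF ltr01 t0.
rewrite {2}/F !subrr expr2 !mulr0 !subr0 => E.
rewrite -/(F t) E normrM.
have -> : (t - 1) ^+ 2 = `|t - 1| * `|t - 1| by rewrite -expr2 real_normK ?num_real.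
rewrite mulrA; apply: ler_wpM2r => //.
apply: le_trans (H c _) _; last by apply: ler_wpM2l => //; exact: ltW.
by apply: le_lt_trans ct _; apply: le_lt_trans td _; lra.
Qed.

(** The mean value theorem, used twice, gives the tangent inequality; averaging the tangents at z =
    t x + (1 - t) y cancels the slope terms. *)
Lemma convex_pos_derive2 f f1 f2 : (forall x, 0 < x -> is_derive x 1 f (f1 x)) ->
  (forall x, 0 < x -> is_derive x 1 f1 (f2 x)) ->
  (forall x, 0 < x -> 0 <= f2 x) -> convex_pos f.
Proof.
move=> df df1 f20 x y t x0 y0 /andP[t0 t1].
have tangent u v : 0 < u -> 0 < v -> f u + f1 u * (v - u) <= f v.
  move=> u0 v0.
  have [c [c0 _ c1 c2 E2]] := MVT_pos f _ u v df u0 v0.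
  have [b [b0 _ _ _ E1]] := MVT_pos f1 _ u c df1 u0 c0.
  have fb := f20 b b0.
  suff : 0 <= (f1 c - f1 u) * (v - u) by lra.
  rewrite E1 -mulrA; apply: mulr_ge0 => //.
  by have [/c1|/ltW/c2] := leP u v; nra.
set z := t * x + (1 - t) * y.
have z0 : 0 < z.
  by rewrite /z; move: t0; rewrite le_eqVlt => /predU1P[<-|t0]; [lra|nra].
have t1' : 0 <= 1 - t by rewrite subr_ge0.
have := ler_wpM2l t0 (tangent z x z0 x0).
have := ler_wpM2l t1' (tangent z y z0 y0).
have -> : x - z = (1 - t) * (x - y) by rewrite /z; ring.
have -> : y - z = - t * (x - y) by rewrite /z; ring.
lra.
Qed.

Lemma convex_quadratic_derive2 f f1 f2 : (forall x, 0 < x -> is_derive x 1 f (f1 x)) ->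
  (forall x, 0 < x -> is_derive x 1 f1 (f2 x)) ->
  (forall x, 0 < x -> 0 <= f2 x) -> f 1 = 0 -> f1 1 = 0 ->
  convex_pos f /\ quadratic_at1 f (f2 1).
Proof.
move=> df df1 f20 f10 f110; split; first exact: convex_pos_derive2 df df1 f20.
have := quadratic_at1_derive f f1 (f2 1) df (df1 1 ltr01).
by rewrite f10 f110; under eq_fun do rewrite subr0 mul0r subr0.
Qed.

Lemma convex_quadratic_xlnx :
  convex_pos (fun t => t * ln t - (t - 1)) /\ quadratic_at1 (fun t => t * ln t - (t - 1)) 1.
Proof.
rewrite -[X in quadratic_at1 _ X](invr1 R).
apply: (convex_quadratic_derive2 _ (@ln R) (@GRing.inv R)).
- move=> x x0; have ? := is_derive1_ln x0.
  by apply: is_derive_eq; rewrite /GRing.scale /=; field; lra.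
- by move=> x x0; rewrite invr_ge0 ltW.
- by rewrite ln1; lra.
- by rewrite ln1.
Qed.

(** The factor 1 / (a (a - 1)) normalises the second derivative to t^(a - 2), so k is convex with
    unit curvature at 1 on both sides of a = 1. *)
Lemma convex_quadratic_powR a : 0 < a -> a != 1 ->
  let k t := (t `^ a - 1 - a * (t - 1)) / (a * (a - 1)) in
  convex_pos k /\ quadratic_at1 k 1.
Proof.
move=> a0 a1 k; have a10 : a - 1 != 0 by rewrite subr_eq0.
have an0 : a != 0 by rewrite gt_eqF.
have -> : 1 = 1 `^ (a - 1 - 1) :> R by rewrite powR1.
apply: (convex_quadratic_derive2 _ (fun t => (t `^ (a - 1) - 1) / (a - 1)) (fun t => t `^ (a - 1 - 1))).
- move=> x x0; have ? := is_derive1_powR a x0.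
  by rewrite /k; apply: is_derive_eq; rewrite /GRing.scale /=; field; apply/andP.
- move=> x x0; have ? := is_derive1_powR (a - 1) x0.
  by apply: is_derive_eq; rewrite /GRing.scale /=; field.
- by move=> x x0; exact: powR_ge0.
- by rewrite /k powR1 !subrr mulr0 subr0 mul0r.
- by rewrite powR1 !subrr mul0r.
Qed.

End Calculus.

(** * From a convex function to the chi-square distance *)

Section ChiSquare.
Context {R : realType} {X : finType}.
Implicit Types (k : R -> R) (P Q w : X -> R) (a c e eta r t : R).

Lemma quadratic_at1_value k a : quadratic_at1 k a -> k 1 = 0.
Proof.
move=> /(_ 1 ltr01) [d [d0 _ /(_ 1)]].
by rewrite !subrr normr0 expr2 !mulr0 subr0 normr_le0 => /(_ (ltW d0))/eqP.
Qed.

(** The point 1 + d or 1 - d lies between 1 and t, with weight d / |t - 1| on t, so convexity and k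
    1 = 0 carry the bound outwards linearly. *)
Lemma convex_linear_growth k d c : convex_pos k -> k 1 = 0 -> 0 < d -> d < 1 ->
  c * d <= k (1 + d) -> c * d <= k (1 - d) ->
  forall t, 0 < t -> d <= `|t - 1| -> c * `|t - 1| <= k t.
Proof.
move=> kconv k1 d0 d1 kp km t t0 dt.
have n0 : 0 < `|t - 1| by apply: lt_le_trans dt.
have s01 : 0 <= d / `|t - 1| <= 1.
  by rewrite divr_ge0 ?(ltW d0) ?(ltW n0) //= ler_pdivrMr // mul1r.
have := kconv t 1 _ t0 ltr01 s01; rewrite k1 mulr0 addr0 => H.
have {H} : c * d <= d / `|t - 1| * k t.
  apply: le_trans H; have [t1|t1] := leP 1 t.
    rewrite ger0_norm ?subr_ge0 // in n0 *.
    suff -> : d / (t - 1) * t + (1 - d / (t - 1)) * 1 = 1 + d by [].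
    by field; lra.
  rewrite ltr0_norm ?subr_lt0 // in n0 *.
  suff -> : d / - (t - 1) * t + (1 - d / - (t - 1)) * 1 = 1 - d by [].
  by field; lra.
by rewrite mulrC -mulrA ler_pM2l // ler_pdivlMl // mulrC.
Qed.

Lemma full_support_lbound Q : full_support Q -> exists2 q, 0 < q & forall x, q <= Q x.
Proof.
move=> Q0; have S0 : 0 <= \sum_x (Q x)^-1.
  by apply: sumr_ge0 => x _; rewrite invr_ge0 ltW.
(* The sum of inverses replaces a minimum over X; adding 1 keeps it positive even for an empty X. *)
exists (1 + \sum_x (Q x)^-1)^-1; first by rewrite invr_gt0; lra.
move=> x; rewrite invf_ple ?posrE //; last by lra.
rewrite (bigD1 x) //= addrCA lerDl; apply: addr_ge0 => //.
by apply: sumr_ge0 => y _; rewrite invr_ge0 ltW.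
Qed.

Lemma fun_ubound w : exists2 b, 0 < b & forall x, `|w x| <= b.
Proof.
exists (1 + \sum_x `|w x|); first by rewrite ltr_pwDl // sumr_ge0.
move=> x; rewrite (bigD1 x) //= addrCA lerDl.
by apply: addr_ge0 => //; apply: sumr_ge0.
Qed.

(* [phi] is the summand of the divergence. Where [P x = 0] it is only required to dominate
   the chord slopes of [k], which covers both [Q x * f'(oo)] and the Renyi case [a < 1]. *)
Lemma chi_square_le Q k a : full_support Q -> convex_pos k -> quadratic_at1 k a -> 0 < a ->
  forall eta, 0 < eta -> exists2 dlt, 0 < dlt & forall r P (phi : X -> R),
    r < dlt -> (forall x, 0 <= P x) ->
    (forall x, 0 < P x -> phi x = P x * k (Q x / P x)) ->
    (forall x, P x = 0 -> forall e, 0 < e -> Q x * (k (1 + e) / e) <= phi x) ->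
    \sum_x phi x <= r ->
    \sum_x (P x - Q x) ^+ 2 / Q x <= (1 + eta) * (2 / a) * r.
Proof.
move=> Q0 kconv kq a0 eta eta0.
have k1 := quadratic_at1_value _ _ kq.
(* chosen so that [(1 + eta) (1 - mu)^2 >= 1] *)
pose mu := eta / (2 * (1 + eta)).
have mu0 : 0 < mu by rewrite divr_gt0 //; lra.
have mu1 : mu < 1 by rewrite ltr_pdivrMr; lra.
have mueta : 1 <= (1 + eta) * (1 - mu) ^+ 2.
  have : (1 + eta) * (1 - 2 * mu) = 1 by rewrite /mu; field; lra.
  by have := sqr_ge0 mu; nra.
have [d1 [d10 d11 kd1]] := kq (a / 2 * mu) ltac:(nra).
(* The bound by mu makes Q x / P x >= 1 - mu at every near point. *)
pose d := Num.min d1 mu.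
have d0 : 0 < d by rewrite lt_min d10.
have dd1 : d <= d1 by rewrite ge_min lexx.
have dmu : d <= mu by rewrite ge_min lexx orbT.
have kd t : `|t - 1| <= d -> a / 2 * (1 - mu) * (t - 1) ^+ 2 <= k t.
  move=> td; have := kd1 t (le_trans td dd1); rewrite ler_norml; lra.
have k0 : 0 < a / 2 * (1 - mu) by apply: mulr_gt0; lra.
pose kap := a / 2 * (1 - mu) * d.
have kap0 : 0 < kap by apply: mulr_gt0.
have kp : kap * d <= k (1 + d).
  rewrite /kap -mulrA -expr2; have := kd (1 + d).
  have -> : 1 + d - 1 = d by ring.
  by apply; rewrite gtr0_norm.
have km : kap * d <= k (1 - d).
  rewrite /kap -mulrA -expr2; have := kd (1 - d).
  have -> : 1 - d - 1 = - d by ring.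
  by rewrite sqrrN normrN; apply; rewrite gtr0_norm.
have kfar := convex_linear_growth _ _ _ kconv k1 d0 (le_lt_trans dd1 d11) kp km.
have [q q0 qQ] := full_support_lbound _ Q0.
(* A ratio farther than d from 1 forces |Q x - P x| >= d / (1 + d) Q x, so a far point costs at
   least rho Q x >= rho q. *)
pose rho := kap * (d / (1 + d)).
have rho0 : 0 < rho by apply: mulr_gt0 => //; apply: divr_gt0 => //; lra.
exists (rho * q); first exact: mulr_gt0.
move=> r P phi rq P0 phiE phi0 phir.
have far x : P x = 0 \/ 0 < P x /\ d < `|Q x / P x - 1| -> rho * q <= phi x.
  move=> H; apply: le_trans (_ : rho * Q x <= _); first by rewrite ler_pM2l.
  case: H => [Px|[Px H]].
    have := phi0 x Px d d0; apply: le_trans.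
    rewrite mulrC ler_pM2l // ler_pdivlMr // /rho; apply: le_trans kp.
    rewrite ler_pM2r // ler_piMr ?ltW // ?ltr_pdivrMr; lra.
  rewrite phiE //; have := kfar (Q x / P x) (divr_gt0 (Q0 x) Px) (ltW H).
  rewrite -(ler_pM2l Px); apply: le_trans.
  rewrite /rho -mulrA [P x * _]mulrCA ler_pM2l // mulrAC ler_pdivrMr; last lra.
  have PE : P x * `|Q x / P x - 1| = `|Q x - P x|.
    by rewrite -{1}(gtr0_norm Px) -normrM mulrBr mulr1 mulrCA divff ?mulr1 // gt_eqF.
  have dP : d * P x <= `|Q x - P x| by rewrite -PE mulrC ler_pM2l // ltW.
  rewrite PE; have := ler_norm (Q x - P x); nra.
have near x : 0 < P x -> `|Q x / P x - 1| <= d ->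
    0 <= phi x /\ (P x - Q x) ^+ 2 / Q x <= (1 + eta) * (2 / a) * phi x.
  move=> Px H; rewrite phiE //.
  have Pn0 : P x != 0 by rewrite gt_eqF.
  have Qn0 : Q x != 0 by rewrite gt_eqF.
  set t := Q x / P x in H *.
  have tmu : 1 - mu <= t by move: H; rewrite ler_norml; lra.
  have chi0 : 0 <= (P x - Q x) ^+ 2 / Q x by rewrite divr_ge0 ?sqr_ge0 // ltW.
  have E : a / 2 * (1 - mu) ^+ 2 * ((P x - Q x) ^+ 2 / Q x) <= P x * k t.
    apply: le_trans (_ : P x * (a / 2 * (1 - mu) * (t - 1) ^+ 2) <= _); last first.
      by rewrite ler_pM2l //; exact: kd.
    (* P (t - 1)^2 = t (P - Q)^2 / Q, so passing to chi-square costs one more factor t >= 1 - mu. *)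
    have -> : P x * (a / 2 * (1 - mu) * (t - 1) ^+ 2) =
        a / 2 * (1 - mu) * ((P x - Q x) ^+ 2 / Q x) * t.
      by rewrite /t; field; apply/andP.
    rewrite expr2 [a / 2 * _]mulrA mulrAC.
    by apply: ler_wpM2l => //; apply: mulr_ge0 => //; exact: ltW.
  split; first by apply: le_trans E; rewrite mulr_ge0 // mulr_ge0 ?sqr_ge0 //; lra.
  rewrite -(@ler_pM2l _ (a / 2)); last lra.
  have -> : a / 2 * ((1 + eta) * (2 / a) * (P x * k t)) = (1 + eta) * (P x * k t).
    by field; lra.
  apply: le_trans (_ : (1 + eta) * (a / 2 * (1 - mu) ^+ 2 * ((P x - Q x) ^+ 2 / Q x)) <= _); last first.
    by rewrite ler_pM2l //; lra.
  have -> : (1 + eta) * (a / 2 * (1 - mu) ^+ 2 * ((P x - Q x) ^+ 2 / Q x)) =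
     (1 + eta) * (1 - mu) ^+ 2 * (a / 2 * ((P x - Q x) ^+ 2 / Q x)) by ring.
  by apply: ler_peMl => //; apply: mulr_ge0 => //; lra.
have trich x : (P x = 0 \/ 0 < P x /\ d < `|Q x / P x - 1|) \/
    (0 < P x /\ `|Q x / P x - 1| <= d).
  have := P0 x; rewrite le_eqVlt => /predU1P[<-|Px]; first by left; left.
  by case: (leP `|Q x / P x - 1| d); [right|left; right].
have phi_ge0 x : 0 <= phi x.
  case: (trich x) => [/far|[Px /(near x Px)[]//]].
  by apply: le_trans; apply: mulr_ge0; exact: ltW.
have phi_le x : phi x <= r.
  by apply: le_trans phir; rewrite (bigD1 x) //= lerDl sumr_ge0.
apply: le_trans (_ : (1 + eta) * (2 / a) * \sum_x phi x <= _); last first.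
  by apply: ler_wpM2l => //; rewrite mulr_ge0 ?divr_ge0 //; lra.
rewrite mulr_sumr; apply: ler_sum => x _.
(* A far point would by itself cost rho q > r; hence every point is near. *)
case: (trich x) => [/far H|[Px /(near x Px)[]//]].
by have := le_lt_trans (le_trans H (phi_le x)) rq; rewrite ltxx.
Qed.

(** With y = 1 + c w the ratio is 1 / y and y (1 / y - 1)^2 = (c w)^2 / y; the factor 1 / y goes
    into the slack since y is uniformly close to 1. *)
Lemma divergence_le Q k a w : full_support Q -> quadratic_at1 k a -> 0 < a ->
  forall eta, 0 < eta -> exists2 dlt, 0 < dlt & forall c, 0 < c < dlt -> forall x,
    0 < 1 + c * w x /\
    Q x * (1 + c * w x) * k (Q x / (Q x * (1 + c * w x))) <=
      (1 + eta) * (a / 2) * c ^+ 2 * (Q x * w x ^+ 2).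
Proof.
move=> Q0 kq a0 eta eta0.
(* Chosen so that (1 + mu) / (1 - mu) = 1 + eta. *)
pose mu := eta / (2 + eta).
have mu0 : 0 < mu by rewrite divr_gt0 //; lra.
have mu1 : mu < 1 by rewrite ltr_pdivrMr; lra.
have mueta : 1 + mu = (1 + eta) * (1 - mu) by rewrite /mu; field; lra.
have [d [d0 d1 kd]] := kq (a / 2 * mu) ltac:(nra).
have [b b0 wb] := fun_ubound w.
(* The bound mu gives y >= 1 - mu; the bound d / 2 gives y >= 1 / 2 and then |1 / y - 1| <= d. *)
pose m := Num.min mu (d / 2).
have m0 : 0 < m by rewrite lt_min mu0 /=; lra.
exists (m / b); first exact: divr_gt0.
move=> c /andP[c0 cb] x.
have cw : `|c * w x| <= m.
  rewrite normrM gtr0_norm //; apply: le_trans (_ : c * b <= _); first by rewrite ler_pM2l.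
  by rewrite -ler_pdivlMr // ltW.
have : `|c * w x| <= mu by apply: le_trans cw _; rewrite ge_min lexx.
have : `|c * w x| <= d / 2 by apply: le_trans cw _; rewrite ge_min lexx orbT.
set v := c * w x => vd vmu; set y := 1 + v.
have y1 : 1 - mu <= y by move: vmu; rewrite ler_norml /y; lra.
have y0 : 0 < y by lra.
have y2 : 1 / 2 <= y by move: vd; rewrite ler_norml /y; lra.
split => //; have Qn0 : Q x != 0 by rewrite gt_eqF.
have -> : Q x / (Q x * y) = y^-1 by field; rewrite Qn0 gt_eqF.
have E : y^-1 - 1 = - (v / y) by rewrite /y; field; rewrite gt_eqF.
have td : `|y^-1 - 1| <= d.
  rewrite E normrN normrM normfV (gtr0_norm y0) ler_pdivrMr //; nra.
have := kd _ td; rewrite ler_norml => /andP[_].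
rewrite lerBlDr => H.
apply: le_trans (_ : Q x * y * (a / 2 * (1 + mu) * (y^-1 - 1) ^+ 2) <= _).
  by rewrite ler_pM2l; [lra|exact: mulr_gt0].
have -> : Q x * y * (a / 2 * (1 + mu) * (y^-1 - 1) ^+ 2) =
   (1 + mu) * y^-1 * (a / 2 * Q x * v ^+ 2).
  by rewrite E; field; rewrite gt_eqF.
have -> : (1 + eta) * (a / 2) * c ^+ 2 * (Q x * w x ^+ 2) =
   (1 + eta) * (a / 2 * Q x * v ^+ 2) by rewrite /v; ring.
apply: ler_wpM2r; first by rewrite mulr_ge0 ?sqr_ge0 // mulr_ge0 ?(ltW (Q0 x)) //; lra.
by rewrite ler_pdivrMr // mueta ler_pM2l //; lra.
Qed.

End ChiSquare.

(** * f-divergences and relative entropy *)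

Section Divergences.
Import numFieldNormedType.Exports.
Local Open Scope classical_set_scope.
Context {R : realType} {X : finType}.
Implicit Types (f k : R -> R) (P Q w : X -> R) (a c e eta r t : R).
Implicit Type d : (X -> R) -> (X -> R) -> \bar R.

(* [d(Q, .)] behaves like [(a / 2) * chi2(., Q)]: from below on small balls, and from above
   along the rays [Q (1 + c w)]. *)
Definition locally_chi_square d a Q : Prop :=
  (forall eta, 0 < eta -> exists2 dlt, 0 < dlt & forall r P, 0 < r < dlt ->
     div_ball d Q r P ->
     \sum_x (P x - Q x) ^+ 2 / Q x <= (1 + eta) * (2 / a) * r) /\
  (forall w, \sum_x Q x * w x = 0 -> forall eta, 0 < eta ->
     exists2 dlt, 0 < dlt & forall c, 0 < c < dlt ->
     (forall x, 0 < 1 + c * w x) /\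
     (d Q (fun x => Q x * (1 + c * w x))%R
       <= ((1 + eta) * (a / 2) * c ^+ 2 * \sum_x Q x * w x ^+ 2)%R%:E)%E).

Lemma sum_perturbation Q w c : \sum_x Q x = 1 -> \sum_x Q x * w x = 0 ->
  \sum_x Q x * (1 + c * w x) = 1.
Proof.
move=> Q1 w0.
have -> : \sum_x Q x * (1 + c * w x) = \sum_x Q x + c * \sum_x Q x * w x.
  by rewrite mulr_sumr -big_split; apply: eq_bigr => x _ /=; ring.
by rewrite Q1 w0 mulr0 addr0.
Qed.

Lemma divergence_sum_le Q k a w : full_support Q -> quadratic_at1 k a -> 0 < a ->
  forall eta, 0 < eta -> exists2 dlt, 0 < dlt & forall c, 0 < c < dlt ->
    (forall x, 0 < 1 + c * w x) /\
    \sum_x Q x * (1 + c * w x) * k (Q x / (Q x * (1 + c * w x))) <=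
      (1 + eta) * (a / 2) * c ^+ 2 * \sum_x Q x * w x ^+ 2.
Proof.
move=> Q0 kq a0 eta eta0.
have [dlt dlt0 H] := divergence_le Q k a w Q0 kq a0 eta eta0.
exists dlt => // c cd; split=> [x|]; first by case: (H c cd x).
by rewrite mulr_sumr; apply: ler_sum => x _; case: (H c cd x).
Qed.

(** Replacing f t by f t - b (t - 1) lowers the slope at infinity by b and leaves the sum unchanged,
    as Q and P have equal mass. *)
Lemma fdiv_EFin f b Q P : is_dist Q -> is_dist P -> full_support Q ->
  ((forall x, 0 < P x) \/ fslope_infty f \is a fin_num) ->
  fdiv f Q P = (\sum_x (if P x == 0 then Q x * (fine (fslope_infty f) - b)
     else P x * (f (Q x / P x) - b * (Q x / P x - 1))))%:E.
Proof.
move=> [_ Q1] [_ P1] Q0 H.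
have -> : \sum_x (if P x == 0 then Q x * (fine (fslope_infty f) - b)
     else P x * (f (Q x / P x) - b * (Q x / P x - 1))) =
   \sum_x (if P x == 0 then Q x * fine (fslope_infty f) else P x * f (Q x / P x)) -
     b * (\sum_x Q x - \sum_x P x).
  rewrite -sumrB mulr_sumr -sumrB; apply: eq_bigr => x _.
  by have [->|Px] := eqVneq (P x) 0; [ring|field].
rewrite Q1 P1 subrr mulr0 subr0 /fdiv -sumEFin; apply: eq_bigr => x _.
have [Px|//] := eqVneq (P x) 0.
rewrite gt_eqF //; case: H => [/(_ x)|sf]; first by rewrite Px ltxx.
by rewrite EFinM fineK.
Qed.

Lemma fslope_infty_ge f t : 1 < t -> (((f t - f 1) / (t - 1))%R%:E <= fslope_infty f)%E.
Proof. by move=> t1; apply: ereal_sup_ubound; exists t. Qed.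

Lemma fslope_inftyNy f : fslope_infty f != -oo%E.
Proof.
have := fslope_infty_ge f 2 ltac:(lra).
by case: (fslope_infty f) => // _; rewrite lee_fin.
Qed.

(** If the slope at infinity is not finite it is +oo, and a zero of P then makes the divergence +oo,
    since no term can be -oo. *)
Lemma fdiv_finite f Q P r : full_support Q -> (forall x, 0 <= P x) ->
  (fdiv f Q P <= r%:E)%E -> (forall x, 0 < P x) \/ fslope_infty f \is a fin_num.
Proof.
move=> Q0 P0; have [sf _|] := boolP (fslope_infty f \is a fin_num); first by right.
have := fslope_inftyNy f.
case E : (fslope_infty f) => [s| |] // _ _ H; left=> x.
rewrite lt_neqAle P0 andbT; apply/eqP => Px.
suff : fdiv f Q P = +oo%E by move=> F; rewrite F in H.
rewrite /fdiv; apply/esum_eqyP.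
  move=> y _; case: ifP => // _.
  by rewrite (gt_eqF (Q0 y)) E mulry gtr0_sg // mul1e.
exists x; rewrite mem_index_enum -Px eqxx (gt_eqF (Q0 x)) E mulry gtr0_sg //.
by rewrite mul1e.
Qed.

Lemma fdiv_chi_square f Q : is_dist Q -> full_support Q -> convex_pos f ->
  (forall x, 0 < x -> derivable f x 1 /\ derivable f^`() x 1) ->
  f 1 = 0 -> 0 < f^`(2) 1 -> locally_chi_square (fdiv f) (f^`(2) 1)%classic Q.
Proof.
move=> dQ Q0 fconv fder f1 a0; set a := f^`(2) 1 in a0 *.
pose b := f^`() 1; pose k t := f t - b * (t - 1).
have kconv : convex_pos k.
  by move=> x y t x0 y0 t01; have := fconv x y t x0 y0 t01; rewrite /k; lra.
have kq : quadratic_at1 k a.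
  have := @quadratic_at1_derive R f f^`() a _ _.
  rewrite f1; under eq_fun do rewrite subr0; apply.
    by move=> x /fder[H _]; rewrite derive1E; apply: derivableP.
  by have [_ H] := fder 1 ltr01; rewrite /a derive1nS derive1E; apply: derivableP.
split=> [eta eta0|w w0 eta eta0].
  have [dlt dlt0 H] := chi_square_le Q k a Q0 kconv kq a0 eta eta0.
  exists dlt => // r P /andP[r0 rd] [dP].
  have [P0 _] := dP; move=> dr.
  have fin := fdiv_finite _ _ _ _ Q0 P0 dr.
  rewrite (fdiv_EFin f b Q P dQ dP Q0 fin) lee_fin in dr.
  apply: (H r P _ rd P0 _ _ dr) => x Px; first by rewrite gt_eqF.
  move=> e e0; rewrite Px eqxx ler_pM2l //.
  case: fin => [/(_ x)|sf]; first by rewrite Px ltxx.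
  (* At a zero of P, the chord slope of k on [1, 1 + e] is that of f minus b, hence at most f'(oo) -
     b. *)
  have := fslope_infty_ge f (1 + e) ltac:(lra).
  rewrite -(fineK sf) lee_fin f1 /k.
  have -> : 1 + e - 1 = e by ring.
  rewrite subr0 mulrBl mulfK ?gt_eqF //; lra.
have [dlt dlt0 H] := divergence_sum_le Q k a w Q0 kq a0 eta eta0.
exists dlt => // c cd; have [c1 c2] := H c cd; split=> //.
have P0 x : 0 < Q x * (1 + c * w x) by apply: mulr_gt0.
rewrite (fdiv_EFin f b) //; last 2 first.
- by split=> [x|]; [exact: ltW|apply: sum_perturbation => //; case: dQ].
- by left.
rewrite lee_fin; apply: le_trans c2; apply: ler_sum => x _.
by rewrite gt_eqF.
Qed.

(** Relative entropy is the f-divergence of t ln t - (t - 1); as Q has full support, a finite value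
    forces P > 0 everywhere. *)
Lemma KL_chi_square Q : is_dist Q -> full_support Q -> locally_chi_square (@KL R X) 1 Q.
Proof.
move=> dQ Q0; have [kconv kq] := @convex_quadratic_xlnx R.
set k := fun t => _ in kconv kq.
have KLE P : is_dist P -> (forall x, 0 < P x) ->
    KL Q P = (\sum_x P x * k (Q x / P x))%:E.
  move=> [_ P1] P0; rewrite /KL ifT; last first.
    by apply/forallP => x; apply/implyP; rewrite gt_eqF.
  congr EFin; rewrite /relent.
  have -> : \sum_x P x * k (Q x / P x) =
     \sum_x (Q x * ln (Q x / P x)) - (\sum_x Q x - \sum_x P x).
    rewrite -!sumrB; apply: eq_bigr => x _; rewrite /k; field.
    by rewrite gt_eqF.
  case: dQ => _ ->; rewrite P1 subrr subr0; apply: eq_bigr => x _.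
  by rewrite gt_eqF.
split=> [eta eta0|w w0 eta eta0].
  have [dlt dlt0 H] := chi_square_le Q k 1 Q0 kconv kq ltr01 eta eta0.
  exists dlt => // r P /andP[r0 rd] [dP].
  have [P0' _] := dP; move=> dr.
  have P0 x : 0 < P x.
    move: dr; rewrite /KL; case: ifP => // /forallP/(_ x)/implyP PQ _.
    rewrite lt_neqAle P0' andbT eq_sym; apply/negP => /PQ.
    by rewrite gt_eqF.
  rewrite KLE // lee_fin in dr.
  apply: (H r P (fun x => P x * k (Q x / P x)) rd P0' _ _ dr) => // x Px.
  by have := P0 x; rewrite Px ltxx.
have [dlt dlt0 H] := divergence_sum_le Q k 1 w Q0 kq ltr01 eta eta0.
exists dlt => // c cd; have [c1 c2] := H c cd; split=> //.
have P0 x : 0 < Q x * (1 + c * w x) by apply: mulr_gt0.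
rewrite KLE ?lee_fin // ; split=> [x|]; first exact: ltW.
by apply: sum_perturbation => //; case: dQ.
Qed.

End Divergences.

(** * Renyi divergences *)

Section Renyi.
Context {R : realType} {X : finType}.
Implicit Types (P Q w : X -> R) (a b c e eta r t z : R).

Lemma ln1D_ge z : 0 < 1 + z -> z / (1 + z) <= ln (1 + z).
Proof.
move=> z1; have E : 1 + - (z / (1 + z)) = (1 + z)^-1 by field; rewrite gt_eqF.
have := @le_ln1Dx R (- (z / (1 + z))).
have -> : -1 < - (z / (1 + z)) by rewrite -subr_gt0 opprK addrC E invr_gt0.
by rewrite E lnV ?posrE // => /(_ isT); rewrite lerN2.
Qed.

(** A Renyi divergence is b^-1 ln (1 + b z) with b = a - 1 and z equal to a times an f-divergence;
    this recovers z. For b < 0 one even gets z <= r; for b > 0 the loss 1 / (1 - r b) is at most 1 +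
    eta by the choice of [dlt]. *)
Lemma le_of_ln1D b eta : b != 0 -> 0 < eta -> exists2 dlt, 0 < dlt & forall r z,
  0 < r < dlt -> 0 < 1 + b * z -> b^-1 * ln (1 + b * z) <= r -> z <= (1 + eta) * r.
Proof.
move=> b0 eta0; exists (eta / (`|b| * (1 + eta))).
  by rewrite divr_gt0 // mulr_gt0 ?normr_gt0 //; lra.
move=> r z /andP[r0]; rewrite ltr_pdivlMr; last first.
  by rewrite mulr_gt0 ?normr_gt0 //; lra.
move=> rd s0; have H := ln1D_ge (b * z) s0.
have [bneg|bpos|/esym/eqP] := ltgtP b 0; last by rewrite eq_sym (negbTE b0).
  rewrite ler_ndivrMl // => H1.
  have : ln (1 + b * z) <= b * z by apply: le_ln1Dx; lra.
  move=> H2; have zr : z <= r by rewrite -(ler_nM2l bneg); lra.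
  by nra.
rewrite ler_pdivrMl // => H1; rewrite gtr0_norm // in rd.
have := le_trans H H1; rewrite ler_pdivrMr // => H2.
have H3 : z <= r * (1 + b * z) by rewrite -(ler_pM2l bpos); lra.
have p1 : 1 <= (1 + eta) * (1 - r * b) by lra.
have p0 : 0 < 1 - r * b by nra.
by rewrite -(ler_pM2r p0); have := ler_wpM2l (ltW r0) p1; lra.
Qed.

(** Smallness is asked of the explicit bound y, as z is controlled only from above. The lossy case
    is now b < 0. *)
Lemma ln1D_le b eta : b != 0 -> 0 < eta -> exists2 dlt, 0 < dlt & forall z y,
  z <= y -> 0 <= y < dlt -> 0 < 1 + b * z -> b^-1 * ln (1 + b * z) <= (1 + eta) * y.
Proof.
move=> b0 eta0; exists (eta / (`|b| * (1 + eta))).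
  by rewrite divr_gt0 // mulr_gt0 ?normr_gt0 //; lra.
move=> z y zy /andP[y0]; rewrite ltr_pdivlMr; last first.
  by rewrite mulr_gt0 ?normr_gt0 //; lra.
move=> yd s0.
have [bneg|bpos|/esym/eqP] := ltgtP b 0; last by rewrite eq_sym (negbTE b0).
  rewrite ler_ndivrMl //; rewrite ltr0_norm // in yd.
  have := ln1D_ge (b * z) s0; apply: le_trans.
  rewrite ler_pdivlMr //; have bz : b * y <= b * z by rewrite ler_nM2l.
  have H : y <= (1 + eta) * y * (1 + b * y).
    rewrite -[leLHS]mul1r mulrAC; apply: ler_wpM2r => //; nra.
  have H2 : z <= (1 + eta) * y * (1 + b * z).
    apply: le_trans zy _; apply: le_trans H _.
    by rewrite ler_wpM2l // ?mulr_ge0 //; lra.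
  by rewrite -mulrA ler_nM2l.
rewrite ler_pdivrMl //; apply: le_trans (_ : b * z <= _); first by apply: le_ln1Dx; lra.
by rewrite ler_pM2l //; nra.
Qed.

Lemma powR_div Q P a x : 0 < Q x -> 0 < P x ->
  Q x `^ a * P x `^ (1 - a) = P x * (Q x / P x) `^ a.
Proof.
move=> Qx Px; rewrite powRM ?invr_ge0 ?ltW // -powR_inv1 ?ltW // -powRrM mulN1r.
rewrite powRD ?(gt_eqF Px) ?implybT // powRr1 ?ltW //; ring.
Qed.

(** The value - Q x / (a - 1) at a zero of P is Q x times the slope at infinity of k, which is
    finite for a < 1. *)
Lemma renyi_sumE a Q P : 0 < a -> a != 1 -> is_dist Q -> is_dist P -> full_support Q ->
  ((forall x, 0 < P x) \/ a < 1) ->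
  let k t := (t `^ a - 1 - a * (t - 1)) / (a * (a - 1)) in
  \sum_x (Q x `^ a * P x `^ (1 - a)) = 1 + (a - 1) * (a *
    \sum_x (if P x == 0 then - Q x / (a - 1) else P x * k (Q x / P x))).
Proof.
move=> a0 a1 [_ Q1] [P0 P1] Q0 H k.
have a10 : a - 1 != 0 by rewrite subr_eq0.
have an0 : a != 0 by rewrite gt_eqF.
rewrite mulrA mulr_sumr.
(* Splits 1 into the constant and linear terms that k subtracts. *)
have E : 1 = \sum_x P x + a * (\sum_x Q x - \sum_x P x) by rewrite Q1 P1; ring.
rewrite [X in _ = X + _]E -sumrB mulr_sumr -!big_split /=; apply: eq_bigr => x _.
have [Px|Px] := eqVneq (P x) 0.
  case: H => [/(_ x)|alt]; first by rewrite Px ltxx.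
  rewrite Px powR0; last by rewrite subr_eq0 eq_sym.
  by field.
have Pp : 0 < P x by rewrite lt_neqAle eq_sym Px P0.
by rewrite powR_div // /k; field; apply/and3P.
Qed.

Lemma sum_powR_gt0 a Q P : is_dist Q -> full_support Q -> (forall x, 0 < P x) ->
  0 < \sum_x (Q x `^ a * P x `^ (1 - a)).
Proof.
move=> [_ Q1] Q0 P0; case: (pickP (@predT X)) => [x _|X0]; last first.
  by move: Q1; rewrite big_pred0 // => /esym/eqP; rewrite oner_eq0.
rewrite (bigD1 x) //= ltr_pwDl ?mulr_gt0 ?powR_gt0 //.
by apply: sumr_ge0 => y _; rewrite mulr_ge0 ?powR_ge0.
Qed.

Lemma renyi_chi_square a Q : 0 < a -> is_dist Q -> full_support Q ->
  locally_chi_square (@renyi R X a) a Q.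
Proof.
move=> a0 dQ Q0; have [->|a1] := eqVneq a 1.
  suff -> : @renyi R X 1 = @KL R X by exact: KL_chi_square.
  by rewrite /renyi eqxx.
have a10 : a - 1 != 0 by rewrite subr_eq0.
have [kconv kq] := @convex_quadratic_powR R a a0 a1.
set k := fun t => _ in kconv kq.
(* Two approximations, of chi-square and of the logarithm, each cost a factor 1 + e. *)
have small eta : 0 < eta -> exists2 e, 0 < e & (1 + e) * (1 + e) <= 1 + eta.
  move=> eta0; exists (Num.min 1 (eta / 3)); first by rewrite lt_min ltr01 /=; lra.
  set e := Num.min _ _.
  have : e <= 1 by rewrite ge_min lexx.
  have : e <= eta / 3 by rewrite ge_min lexx orbT.
  have : 0 < e by rewrite lt_min ltr01 /=; lra.
  by nra.
split=> [eta /small[e e0 ee]|w w0 eta /small[e e0 ee]].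
  have [d1 d10 H1] := chi_square_le Q k 1 Q0 kconv kq ltr01 e e0.
  have [d2 d20 H2] := le_of_ln1D (a - 1) e a10 e0.
  (* The first bound makes (1 + e) r / a, which dominates the f-divergence, smaller than d1. *)
  exists (Num.min (d1 * a / (1 + e)) d2).
    by rewrite lt_min d20 andbT divr_gt0 ?mulr_gt0 //; lra.
  move=> r P /andP[r0]; rewrite lt_min => /andP[rd1 rd2] [dP].
  have [P0 P1] := dP; rewrite /renyi (negbTE a1); case: ifP => // /negbT.
  rewrite negb_and negbK => HP; set s := \sum_x _; case: eqVneq => // sn0.
  rewrite lee_fin => Hs.
  have s0 : 0 < s.
    rewrite lt_neqAle eq_sym sn0; apply: sumr_ge0 => x _.
    by rewrite mulr_ge0 ?powR_ge0.
  have PP : (forall x, 0 < P x) \/ a < 1.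
    case/orP: HP => [|/forallP HP]; first by rewrite -leNgt le_eqVlt (negbTE a1); right.
    left=> x; rewrite lt_neqAle P0 andbT eq_sym; apply/negP.
    by move/(implyP (HP x)); rewrite gt_eqF.
  pose phi x := if P x == 0 then - Q x / (a - 1) else P x * k (Q x / P x).
  have sE : s = 1 + (a - 1) * (a * \sum_x phi x).
    exact: renyi_sumE a Q P a0 a1 dQ dP Q0 PP.
  have Hphi : a * \sum_x phi x <= (1 + e) * r.
    by apply: H2; rewrite -?sE // r0.
  apply: le_trans (_ : (1 + e) * (2 / 1) * ((1 + e) * r / a) <= _); last first.
    have -> : (1 + e) * (2 / 1) * ((1 + e) * r / a) = (1 + e) * (1 + e) * (2 / a * r).
      by field; rewrite gt_eqF.
    by rewrite -[leRHS]mulrA ler_wpM2r // mulr_ge0 ?divr_ge0 ?(ltW r0) // ltW.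
  apply: (H1 _ P phi) => //.
  - by rewrite ltr_pdivrMr // mulrC -ltr_pdivlMr //; lra.
  - by move=> x Px; rewrite /phi gt_eqF.
  - move=> x Px t t0; rewrite /phi Px eqxx.
    case: PP => [/(_ x)|alt]; first by rewrite Px ltxx.
    rewrite mulNr -mulrN ler_pM2l //.
    have : 1 <= (1 + t) `^ a by rewrite -{1}(powRr0 (1 + t)) ler_powR ?ltW //; lra.
    move=> Hpow; rewrite /k.
    have -> : 1 + t - 1 = t by ring.
    have -> : ((1 + t) `^ a - 1 - a * t) / (a * (a - 1)) / t =
       - (a - 1)^-1 - ((1 + t) `^ a - 1) / (a * (1 - a) * t).
      by field; rewrite a10 !gt_eqF ?subr_gt0.
    rewrite gerBl divr_ge0 ?subr_ge0 // !mulr_ge0 //; lra.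
  - by rewrite ler_pdivlMr // mulrC.
have [d1 d10 H1] := divergence_sum_le Q k 1 w Q0 kq ltr01 e e0.
have [d2 d20 H2] := ln1D_le (a - 1) e a10 e0.
pose W := \sum_x Q x * w x ^+ 2.
have W0 : 0 <= W by apply: sumr_ge0 => x _; rewrite mulr_ge0 ?sqr_ge0 ?ltW.
(* As c <= 1, c K dominates the bound fed to [ln1D_le]; W + 1 keeps K positive when W = 0. *)
pose K := a * ((1 + e) * (1 / 2)) * (W + 1).
have K0 : 0 < K by rewrite !mulr_gt0 //; lra.
exists (Num.min d1 (Num.min 1 (d2 / K))).
  by rewrite !lt_min d10 ltr01 divr_gt0 //.
move=> c; rewrite !lt_min => /and4P[c0 cd1 c1]; rewrite ltr_pdivlMr // => cd2.
have [Hpos Hsum] := H1 c ltac:(by rewrite c0); split=> //.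
set P := fun x => Q x * (1 + c * w x).
have P0 x : 0 < P x by apply: mulr_gt0.
have dP : is_dist P.
  split=> [x|]; first exact/ltW/P0.
  by apply: sum_perturbation => //; case: dQ.
rewrite /renyi (negbTE a1) ifF; last first.
  apply/negbTE; rewrite negb_and negbK; apply/orP; right.
  by apply/forallP => x; apply/implyP; rewrite gt_eqF.
have s0 := sum_powR_gt0 a Q P dQ Q0 P0.
rewrite (gt_eqF s0) lee_fin.
have PP : (forall x, 0 < P x) \/ a < 1 by left.
have sE := renyi_sumE a Q P a0 a1 dQ dP Q0 PP.
have phiE : \sum_x (if P x == 0 then - Q x / (a - 1) else P x * k (Q x / P x)) =
   \sum_x P x * k (Q x / P x) by apply: eq_bigr => x _; rewrite gt_eqF.
rewrite /= phiE in sE; rewrite sE; rewrite sE in s0.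
have c2 : c ^+ 2 <= c by rewrite expr2 ler_piMl // ltW.
have := H2 (a * \sum_x P x * k (Q x / P x)) (a * ((1 + e) * (1 / 2) * c ^+ 2 * W)).
have y0 : 0 <= a * ((1 + e) * (1 / 2) * c ^+ 2 * W).
  apply: mulr_ge0; first exact: ltW.
  by apply: mulr_ge0 => //; apply: mulr_ge0; [lra|exact: sqr_ge0].
rewrite ler_pM2l // => /(_ Hsum); rewrite y0 /= => H.
apply: le_trans (H _ s0) _.
  apply: le_lt_trans cd2; rewrite /K.
  have -> : a * ((1 + e) * (1 / 2) * c ^+ 2 * W) = a * ((1 + e) * (1 / 2)) * (c ^+ 2 * W) by ring.
  have -> : c * (a * ((1 + e) * (1 / 2)) * (W + 1)) = a * ((1 + e) * (1 / 2)) * (c * (W + 1)) by ring.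
  apply: ler_wpM2l; first by apply: mulr_ge0; lra.
  by apply: le_trans (_ : c * W <= _); [exact: ler_wpM2r|rewrite ler_pM2l //; lra].
have -> : (1 + e) * (a * ((1 + e) * (1 / 2) * c ^+ 2 * W)) =
   (1 + e) * (1 + e) * (a / 2 * c ^+ 2 * W) by field.
have -> : (1 + eta) * (a / 2) * c ^+ 2 * W = (1 + eta) * (a / 2 * c ^+ 2 * W) by ring.
apply: ler_wpM2r => //; apply: mulr_ge0 => //.
by apply: mulr_ge0; [lra|exact: sqr_ge0].
Qed.

End Renyi.

(** * Tilting and relative entropy *)

Section Exponents.
Context {R : realType} {X : finType}.
Implicit Types (P Q w u : X -> R) (a b c e eta r t z : R).

Lemma ln_le_sub1 z : 0 < z -> ln z <= z - 1.
Proof.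
move=> z0; have := @le_ln1Dx R (z - 1).
have -> : 1 + (z - 1) = z by ring.
by apply; lra.
Qed.

Lemma ln1D_ge_quadratic z : `|z| <= 1 / 2 -> z - 2 * z ^+ 2 <= ln (1 + z).
Proof.
rewrite ler_norml => /andP[z1 z2]; have z0 : 0 < 1 + z by lra.
apply: le_trans (ln1D_ge z z0); rewrite ler_pdivlMr //.
have -> : (z - 2 * z ^+ 2) * (1 + z) = z - z ^+ 2 * (1 + 2 * z) by ring.
by rewrite gerBl mulr_ge0 ?sqr_ge0 //; lra.
Qed.

(** Weighted Cauchy-Schwarz, with positive upper bounds C and V in place of the two sums, which may
    vanish. *)
Lemma sum_mul_le_sqrt (q v w : X -> R) (C V : R) : full_support q ->
  \sum_x v x ^+ 2 / q x <= C -> \sum_x q x * w x ^+ 2 <= V -> 0 < C -> 0 < V ->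
  \sum_x v x * w x <= Num.sqrt (C * V).
Proof.
move=> q0 HC HV C0 V0; set s := Num.sqrt (C * V).
have s0 : 0 < s by rewrite sqrtr_gt0 mulr_gt0.
have s2 : s * s = C * V by rewrite -expr2 sqr_sqrtr // mulr_ge0 // ltW.
(* AM-GM: 2 v w <= (V/s) (v^2/q) + (s/V) (q w^2), since s^2 = C V balances the two sums. *)
have H : \sum_x v x * w x <=
    V / s / 2 * (\sum_x v x ^+ 2 / q x) + s / V / 2 * (\sum_x q x * w x ^+ 2).
  rewrite !mulr_sumr -big_split; apply: ler_sum => x _ /=.
  have -> : V / s / 2 * (v x ^+ 2 / q x) + s / V / 2 * (q x * w x ^+ 2) =
    v x * w x + (V * v x - s * q x * w x) ^+ 2 / (2 * s * V * q x).
    by field; rewrite !gt_eqF.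
  by rewrite lerDl divr_ge0 ?sqr_ge0 // !mulr_ge0 // ltW.
apply: le_trans H _.
have E : V / s / 2 * C + s / V / 2 * V = s.
  have -> : V / s / 2 * C + s / V / 2 * V = (C * V + s * s) / (2 * s).
    by field; rewrite !gt_eqF.
  by rewrite -s2; field; rewrite gt_eqF.
rewrite -[leRHS]E.
by apply: lerD; apply: ler_wpM2l => //; rewrite !divr_ge0 // ltW.
Qed.

Lemma sum_mul_gt0 P u : is_dist P -> (forall x, 0 < u x) -> 0 < \sum_x P x * u x.
Proof.
move=> [P0 P1] u0; have Pu x : 0 <= P x * u x by rewrite mulr_ge0 // ltW.
rewrite lt_neqAle sumr_ge0 // andbT; apply/eqP => /esym/eqP.
rewrite psumr_eq0 // => /allP H; move: P1; rewrite big1 => [/esym/eqP|x _].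
  by rewrite oner_eq0.
have := H x (mem_index_enum x).
by rewrite mulf_eq0 (gt_eqF (u0 x)) orbF => /eqP.
Qed.

(** Nonnegativity of the divergence of Q from the tilted distribution P u / S, obtained pointwise
    from ln t <= t - 1. *)
Lemma relent_ge Q P u : is_dist Q -> is_dist P -> abs_cont Q P -> (forall x, 0 < u x) ->
  \sum_x Q x * ln (u x) - ln (\sum_x P x * u x) <= relent Q P.
Proof.
move=> [Q0 Q1] dP /forallP QP u0; have [P0 P1] := dP; set S := \sum_x P x * u x.
have S0 : 0 < S by exact: sum_mul_gt0.
rewrite /relent -[ln S]mul1r -Q1 mulr_suml -sumrB -subr_ge0 -sumrB.
apply: le_trans (_ : \sum_x (Q x - P x * u x / S) <= _).
  by rewrite sumrB -mulr_suml Q1 divff ?subrr // gt_eqF.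
apply: ler_sum => x _; have [->|Qx] := eqVneq (Q x) 0.
  by rewrite !mul0r !subrr sub0r oppr_le0 divr_ge0 ?(ltW S0) // mulr_ge0 // ltW.
have Qp : 0 < Q x by rewrite lt_neqAle eq_sym Qx Q0.
have Pp : 0 < P x.
  rewrite lt_neqAle P0 andbT eq_sym; apply/negP => /(implyP (QP x)).
  by rewrite (negbTE Qx).
pose t := P x * u x / (S * Q x).
have t0 : 0 < t by rewrite divr_gt0 // mulr_gt0.
have : ln t <= t - 1.
  exact: ln_le_sub1.
have -> : ln t = ln (u x) - ln S - ln (Q x / P x).
  by rewrite /t !ln_div ?lnM ?posrE ?mulr_gt0 //; ring.
move=> /(ler_wpM2l (Q0 x)).
have -> : Q x * (t - 1) = P x * u x / S - Q x by rewrite /t; field; rewrite !gt_eqF.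
lra.
Qed.

Variables (P0 P1 : X -> R) (l : R).
Hypotheses (dP0 : is_dist P0) (P0_gt0 : full_support P0) (P1_gt0 : full_support P1).

Let Z := \sum_a (P0 a `^ (1 - l) * P1 a `^ l).

Lemma tilt_normalizer_gt0 : 0 < Z.
Proof.
case: (pickP (@predT X)) => [x _|X0]; last first.
  by case: dP0 => _; rewrite big_pred0 // => /esym/eqP; rewrite oner_eq0.
rewrite /Z (bigD1 x) //= ltr_pwDl ?mulr_gt0 ?powR_gt0 //.
by apply: sumr_ge0 => y _; rewrite mulr_ge0 ?powR_ge0.
Qed.

Lemma tilt_gt0 x : 0 < tilt P0 P1 l x.
Proof. by rewrite divr_gt0 ?tilt_normalizer_gt0 // mulr_gt0 // powR_gt0. Qed.

Lemma tilt_dist : is_dist (tilt P0 P1 l).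
Proof.
split=> [x|]; first exact/ltW/tilt_gt0.
by rewrite /tilt -mulr_suml divff // gt_eqF // tilt_normalizer_gt0.
Qed.

Lemma ln_tilt x : ln (tilt P0 P1 l x / P0 x) = l * (ln (P1 x) - ln (P0 x)) - ln Z.
Proof.
have Z0 := tilt_normalizer_gt0.
rewrite ln_div ?posrE ?tilt_gt0 // /tilt ln_div ?posrE ?mulr_gt0 ?powR_gt0 //.
by rewrite lnM ?posrE ?powR_gt0 // !ln_powR /Z; ring.
Qed.

Lemma llrE Q : is_dist Q -> llr P0 P1 Q = \sum_x Q x * (ln (P1 x) - ln (P0 x)).
Proof.
move=> [Q0 _]; rewrite /llr /relent -sumrB; apply: eq_bigr => x _.
have [->|Qx] := eqVneq (Q x) 0; first by rewrite mul0r subrr.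
have Qp : 0 < Q x by rewrite lt_neqAle eq_sym Qx Q0.
by rewrite !ln_div ?posrE //; ring.
Qed.

(** The log-ratio of the tilted distribution is affine in the log-likelihood ratio, so its mean
    depends on Q only through [llr]. *)
Lemma sum_ln_tilt Q : is_dist Q ->
  \sum_x Q x * ln (tilt P0 P1 l x / P0 x) = l * llr P0 P1 Q - ln Z.
Proof.
move=> dQ; have [_ Q1] := dQ; rewrite llrE // mulr_sumr.
rewrite -[ln Z]mul1r -Q1 mulr_suml -sumrB.
by apply: eq_bigr => x _; rewrite ln_tilt; ring.
Qed.

Lemma relent_tilt : relent (tilt P0 P1 l) P0 = l * llr P0 P1 (tilt P0 P1 l) - ln Z.
Proof.
rewrite -sum_ln_tilt; last exact: tilt_dist.
by apply: eq_bigr => x _; rewrite gt_eqF // tilt_gt0.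
Qed.

Lemma var_tilt : var_under P0 (fun x => tilt P0 P1 l x / P0 x) =
  \sum_x P0 x * (tilt P0 P1 l x / P0 x - 1) ^+ 2.
Proof.
have [_ T1] := tilt_dist; have [_ S1] := dP0.
have E : \sum_x P0 x * (tilt P0 P1 l x / P0 x) = 1.
  by rewrite -[RHS]T1; apply: eq_bigr => x _; field; rewrite gt_eqF.
have -> : \sum_x P0 x * (tilt P0 P1 l x / P0 x - 1) ^+ 2 =
   \sum_x P0 x * (tilt P0 P1 l x / P0 x) ^+ 2 -
   2 * (\sum_x P0 x * (tilt P0 P1 l x / P0 x)) + \sum_x P0 x.
  rewrite mulr_sumr -sumrB -big_split; apply: eq_bigr => x _ /=; ring.
by rewrite /var_under E S1; ring.
Qed.

Let w x := tilt P0 P1 l x / P0 x - 1.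

Lemma sum_tilt_dev : \sum_x P0 x * w x = 0.
Proof.
have [_ T1] := tilt_dist; have [_ S1] := dP0.
transitivity (\sum_x (tilt P0 P1 l x - P0 x)); last by rewrite sumrB T1 S1 subrr.
by apply: eq_bigr => x _; rewrite /w; field; rewrite gt_eqF.
Qed.

(** Take u = tilt / P0 in [relent_ge]: the half-space and l >= 0 bound the first term from below,
    and ln S <= S - 1 makes the second linear in P. *)
Lemma relent_Qset0_ge g P Q : 0 <= l -> llr P0 P1 (tilt P0 P1 l) = g ->
  is_dist P -> Qset0 P0 P1 g Q -> abs_cont Q P ->
  relent (tilt P0 P1 l) P0 - \sum_x (P x - P0 x) * w x <= relent Q P.
Proof.
move=> l0 lg dP [dQ gQ] QP; have [Pge0 Psum] := dP; have [_ S1] := dP0.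
have u0 x : 0 < tilt P0 P1 l x / P0 x by rewrite divr_gt0 // tilt_gt0.
apply: le_trans (relent_ge Q P _ dQ dP QP u0).
rewrite sum_ln_tilt // relent_tilt lg lerB //.
  by rewrite lerB // ler_wpM2l.
set S := \sum_x P x * _.
have S0 : 0 < S by exact: sum_mul_gt0.
have -> : \sum_x (P x - P0 x) * w x = S - 1.
  have -> : \sum_x (P x - P0 x) * w x = S - \sum_x P x - \sum_x P0 x * w x.
    by rewrite -!sumrB; apply: eq_bigr => x _; rewrite /w; ring.
  by rewrite sum_tilt_dev Psum; ring.
exact: ln_le_sub1.
Qed.

Lemma relent_tilt_shift c : (forall x, 0 < 1 + c * w x) ->
  relent (tilt P0 P1 l) (fun x => P0 x * (1 + c * w x)) =
  relent (tilt P0 P1 l) P0 - \sum_x tilt P0 P1 l x * ln (1 + c * w x).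
Proof.
move=> c0; rewrite /relent -sumrB; apply: eq_bigr => x _; have T0 := tilt_gt0 x.
move: (1 + c * w x) (c0 x) (tilt P0 P1 l x) T0 => y y0 t t0.
by rewrite (gt_eqF t0) !ln_div ?lnM ?posrE ?mulr_gt0 //; ring.
Qed.

Lemma sum_tilt_w : \sum_x tilt P0 P1 l x * w x =
  var_under P0 (fun x => tilt P0 P1 l x / P0 x).
Proof.
(* As tilt = P0 (1 + w), the two sides differ by the mean of w under P0, which is zero. *)
rewrite var_tilt; apply/eqP; rewrite -subr_eq0 -sumrB -[X in _ == X]sum_tilt_dev.
apply/eqP; apply: eq_bigr => x _; rewrite /w; field; rewrite gt_eqF //.
Qed.

End Exponents.

(** * Expansion of the worst-case exponent *)

Section Expansion.
Context {R : realType} {X : finType}.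
Implicit Types (P Q : X -> R) (a g l r eps : R).

Lemma ler_sqrtD (x y : R) : 0 <= x -> 0 <= y -> Num.sqrt (x + y) <= Num.sqrt x + Num.sqrt y.
Proof.
move=> x0 y0; have s0 : 0 <= Num.sqrt x + Num.sqrt y by rewrite addr_ge0 ?sqrtr_ge0.
rewrite -(ger0_norm s0) -sqrtr_sqr ler_wsqrtr //.
have := mulr_ge0 (sqrtr_ge0 x) (sqrtr_ge0 y).
by rewrite sqrrD !sqr_sqrtr //; lra.
Qed.

Lemma worst_exp_ge (d : (X -> R) -> (X -> R) -> \bar R) (P0 : X -> R) (A : set (X -> R)) r (c : R) :
  (forall P Q, div_ball d P0 r P -> A Q -> abs_cont Q P -> c <= relent Q P) ->
  (c%:E <= worst_exp d P0 A r)%E.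
Proof.
move=> H; apply: le_ereal_inf_tmp => _ [P BP <-].
apply: le_ereal_inf_tmp => _ [Q AQ <-].
by rewrite /KL; case: ifP => [QP|]; [rewrite lee_fin; exact: H|rewrite leey].
Qed.

Lemma worst_exp_le (d : (X -> R) -> (X -> R) -> \bar R) (P0 : X -> R) (A : set (X -> R)) r P Q :
  div_ball d P0 r P -> A Q -> (worst_exp d P0 A r <= KL Q P)%E.
Proof.
move=> BP AQ; apply: (le_trans (ereal_inf_lbound _)); first by exists P.
by apply: ereal_inf_lbound; exists Q.
Qed.

Lemma worst_exp_expansion d a (P0 P1 : X -> R) g l : is_dist P0 -> full_support P0 -> full_support P1 ->
  0 < a -> locally_chi_square d a P0 -> 0 <= l -> llr P0 P1 (tilt P0 P1 l) = g ->
  sqrt_expansion (worst_exp d P0 (Qset0 P0 P1 g)) (relent (tilt P0 P1 l) P0)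
    (2 / a * var_under P0 (fun x => tilt P0 P1 l x / P0 x)).
Proof.
move=> dP0 P0_gt0 P1_gt0 a0 [ball_le ball_in] l0 lg eps eps0.
set E0 := relent _ P0; set V := var_under _ _.
set w := fun x => tilt P0 P1 l x / P0 x - 1.
have VE : V = \sum_x P0 x * w x ^+ 2 by exact: var_tilt.
have V0 : 0 <= V by rewrite VE; apply: sumr_ge0 => x _; rewrite mulr_ge0 ?sqr_ge0 ?ltW.
have a2 : 0 < 2 / a by rewrite divr_gt0.
suff [[d1 d10 H1] [d2 d20 H2]] :
    (exists2 d1, 0 < d1 & forall r, 0 < r < d1 ->
      ((E0 - Num.sqrt (r * (2 / a * V)) - eps * Num.sqrt r)%:E <=
        worst_exp d P0 (Qset0 P0 P1 g) r)%E) /\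
    (exists2 d2, 0 < d2 & forall r, 0 < r < d2 ->
      (worst_exp d P0 (Qset0 P0 P1 g) r <=
        (E0 - Num.sqrt (r * (2 / a * V)) + eps * Num.sqrt r)%:E)%E).
  exists (Num.min d1 d2); split; first by rewrite lt_min d10.
  move=> r /andP[r0]; rewrite lt_min => /andP[rd1 rd2].
  by split; [apply: H1|apply: H2]; rewrite r0.
split.
  (* As tau <= 1, the excess under the square root is at most r (2 / a) tau (V + 2) <= eps^2 r.
     Cauchy-Schwarz is used with V + tau, positive even if V = 0. *)
  pose tau := Num.min 1 (eps ^+ 2 / (2 / a * (V + 2))).
  have V2 : 0 < 2 / a * (V + 2) by rewrite mulr_gt0 //; lra.
  have tau0 : 0 < tau by rewrite lt_min ltr01 divr_gt0 // exprn_gt0.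
  have tau1 : tau <= 1 by rewrite ge_min lexx.
  have tauE : 2 / a * (tau * V + (1 + tau) * tau) <= eps ^+ 2.
    have : tau <= eps ^+ 2 / (2 / a * (V + 2)) by rewrite ge_min lexx orbT.
    rewrite ler_pdivlMr //; apply: le_trans.
    by rewrite [leRHS]mulrCA ler_pM2l //; nra.
  have [dlt dlt0 H] := ball_le tau tau0; exists dlt => // r rd.
  have /andP[r0 _] := rd.
  apply: worst_exp_ge => P Q BP AQ QP.
  apply: le_trans (relent_Qset0_ge P0 P1 l dP0 P0_gt0 P1_gt0 g P Q l0 lg (proj1 BP) AQ QP).
  rewrite -addrA lerD2l -opprD lerN2.
  apply: le_trans (sum_mul_le_sqrt P0 _ w _ (V + tau) P0_gt0 (H r P rd BP) _ _ _) _.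
  - by rewrite -VE lerDl ltW.
  - by rewrite !mulr_gt0 ?invr_gt0 //; lra.
  - lra.
  have -> : (1 + tau) * (2 / a) * r * (V + tau) =
    r * (2 / a * V) + r * (2 / a * (tau * V + (1 + tau) * tau)) by ring.
  apply: le_trans (ler_sqrtD _ _ _ _) _.
  - by rewrite !mulr_ge0 ?invr_ge0 // ltW.
  - by apply: mulr_ge0; [exact: ltW|apply: mulr_ge0; [exact: ltW|nra]].
  rewrite lerD2l -(gtr0_norm eps0) -sqrtr_sqr [leRHS]mulrC -sqrtrM; last exact: ltW.
  by rewrite ler_wsqrtr // ler_pM2l.
pose A := Num.sqrt (2 / a); have A0 : 0 < A by rewrite sqrtr_gt0.
(* Chosen so that A sqrt nu is half of the allowed error; the other half absorbs the quadratic term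
   of the logarithm. *)
pose nu := (eps / (2 * A)) ^+ 2.
have nu0 : 0 < nu by rewrite exprn_gt0 // divr_gt0 // mulr_gt0.
have nuE : A * Num.sqrt nu = eps / 2.
  rewrite sqrtr_sqr ger0_norm; last by rewrite divr_ge0 ?mulr_ge0 // ltW.
  by field; rewrite gt_eqF.
pose B := Num.sqrt (V + nu); have B0 : 0 < B by rewrite sqrtr_gt0; lra.
have B2 : B * B = V + nu by rewrite -expr2 sqr_sqrtr //; lra.
have A2 : A * A = 2 / a by rewrite -expr2 sqr_sqrtr // ltW.
(* The perturbation size is [c = h * sqrt r]: it exhausts the ball up to the slack [nu],
   which also avoids dividing by [V = 0]. *)
pose h := A / B; have h0 : 0 < h by rewrite divr_gt0.
(* Here h V = A (B - nu / B), with B >= sqrt V and nu / B <= sqrt nu. *)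
have hV : A * Num.sqrt V - eps / 2 <= h * V.
  have -> : V = B * B - nu by lra.
  have -> : h * (B * B - nu) = A * B - A * (nu / B) by rewrite /h; field; rewrite gt_eqF.
  have BV : Num.sqrt V <= B by rewrite ler_wsqrtr //; lra.
  have Bnu : Num.sqrt nu <= B by rewrite ler_wsqrtr //; lra.
  have nuB : nu / B <= Num.sqrt nu.
    rewrite ler_pdivrMr // -{1}(sqr_sqrtr (ltW nu0)) expr2.
    by apply: ler_wpM2l => //; exact: sqrtr_ge0.
  rewrite -nuE; have := ler_wpM2l (ltW A0) BV; have := ler_wpM2l (ltW A0) nuB.
  have -> : B * B - nu = V by lra.
  lra.
(* The slack eta = nu / (V + 1) satisfies (1 + eta) V <= V + nu. *)
have nuV : 0 < nu / (V + 1) by rewrite divr_gt0 //; lra.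
have w0 : \sum_x P0 x * w x = 0 by exact: sum_tilt_dev.
have [dlt dlt0 H] := ball_in w w0 _ nuV.
have [b b0 wb] := fun_ubound w.
pose K := \sum_x tilt P0 P1 l x * w x ^+ 2.
have T0 x : 0 < tilt P0 P1 l x by exact: tilt_gt0.
have K0 : 0 <= K by apply: sumr_ge0 => x _; rewrite mulr_ge0 ?sqr_ge0 ?ltW.
(* For sqrt r < sg: c < dlt, |c w| <= 1 / 2, and the quadratic loss 2 c^2 K is at most (eps / 2)
   sqrt r. *)
pose sg := Num.min (dlt / h) (Num.min (1 / 2 / (h * b)) (eps / 2 / (2 * h ^+ 2 * (K + 1)))).
have hK : 0 < 2 * h ^+ 2 * (K + 1) by rewrite mulr_gt0 ?ltr_wpDl // mulr_gt0 ?exprn_gt0.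
have sg0 : 0 < sg by rewrite !lt_min !divr_gt0 // mulr_gt0.
exists (sg ^+ 2); first exact: exprn_gt0.
move=> r /andP[r0 rs]; pose q := Num.sqrt r.
have q0 : 0 < q by rewrite sqrtr_gt0.
have q2 : q * q = r by rewrite -expr2 sqr_sqrtr // ltW.
have : q < sg by rewrite -(gtr0_norm sg0) -sqrtr_sqr ltr_sqrt // exprn_gt0.
rewrite /sg !lt_min (ltr_pdivlMr _ _ h0) (ltr_pdivlMr _ _ (mulr_gt0 h0 b0)).
rewrite (ltr_pdivlMr _ _ hK) => /and3P[q_dlt qb qK].
pose c := q * h; have c0 : 0 < c by rewrite mulr_gt0.
have [cpos dle] := H c ltac:(by rewrite c0).
have BP : div_ball d P0 r (fun x => P0 x * (1 + c * w x)).
  split.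
    split=> [x|]; first by rewrite mulr_ge0 // ltW.
    by apply: sum_perturbation; [case: dP0|exact: sum_tilt_dev].
  apply: le_trans dle _; rewrite lee_fin -VE.
  have c2 : c ^+ 2 = r * (2 / a) / (V + nu).
    by rewrite -B2 -A2 -q2 /c /h; field; rewrite gt_eqF.
  have -> : (1 + nu / (V + 1)) * (a / 2) * c ^+ 2 * V =
      r * ((V + nu * (V / (V + 1))) / (V + nu)).
    by rewrite c2; field; rewrite !gt_eqF //; lra.
  rewrite ger_pMr // ler_pdivrMr; last lra.
  rewrite mul1r lerD2l ger_pMr // ler_pdivrMr; lra.
have AQ : Qset0 P0 P1 g (tilt P0 P1 l) by split; [exact: tilt_dist|rewrite lg].
apply: le_trans (worst_exp_le _ _ _ _ _ _ BP AQ) _.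
rewrite /KL ifT; last first.
  by apply/forallP => x; apply/implyP; rewrite gt_eqF // mulr_gt0.
rewrite lee_fin relent_tilt_shift // -/E0 -addrA lerD2l.
suff : \sum_x tilt P0 P1 l x * (c * w x - 2 * (c * w x) ^+ 2) >=
    Num.sqrt (r * (2 / a * V)) - eps * q.
  have : \sum_x tilt P0 P1 l x * (c * w x - 2 * (c * w x) ^+ 2) <=
      \sum_x tilt P0 P1 l x * ln (1 + c * w x).
    apply: ler_sum => x _; apply: ler_wpM2l; first exact: ltW.
    apply: ln1D_ge_quadratic; rewrite normrM gtr0_norm //.
    apply: le_trans (_ : c * b <= _); first by rewrite ler_pM2l.
    by rewrite /c -mulrA ltW.
  by rewrite -/q; lra.
(* The mean of w under the tilted distribution is V, so the first-order gain is c V. *)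
have -> : \sum_x tilt P0 P1 l x * (c * w x - 2 * (c * w x) ^+ 2) = c * V - 2 * c ^+ 2 * K.
  by rewrite /V -sum_tilt_w // /K !mulr_sumr -sumrB; apply: eq_bigr => x _; rewrite /w; ring.
rewrite (sqrtrM _ (ltW r0)) (sqrtrM _ (ltW a2)) -/A -/q.
have c2K : 2 * c ^+ 2 * K <= q * (eps / 2).
  apply: le_trans (_ : q * (q * (2 * h ^+ 2 * (K + 1))) <= _); last by rewrite ler_pM2l // ltW.
  have -> : q * (q * (2 * h ^+ 2 * (K + 1))) = 2 * c ^+ 2 * K + 2 * c ^+ 2.
    by rewrite /c; ring.
  by rewrite lerDl mulr_ge0 ?sqr_ge0.
have cV : c * V = q * (h * V) by rewrite /c mulrA.
have := ler_wpM2l (ltW q0) hV; rewrite -cV mulrBr.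
lra.
Qed.

End Expansion.

(** * Both families of divergences, and the exchange of the two hypotheses *)

Lemma admissible_chi_square (R : realType) (X : finType)
  (d : (X -> R) -> (X -> R) -> \bar R) (alpha : R) (Q : X -> R) :
  admissible_div d alpha -> is_dist Q -> full_support Q ->
  0 < alpha /\ locally_chi_square d alpha Q.
Proof.
move=> [[a0 ->]|[f [fconv [fder [f1 [-> [a0 ->]]]]]]] dQ Q0; split=> //.
  exact: renyi_chi_square.
exact: fdiv_chi_square.
Qed.

Lemma llrC (R : realType) (X : finType) (P0 P1 Q : X -> R) :
  llr P1 P0 Q = - llr P0 P1 Q.
Proof. by rewrite /llr opprB. Qed.

Lemma tiltC (R : realType) (X : finType) (P0 P1 : X -> R) (l : R) :
  tilt P1 P0 (1 - l) = tilt P0 P1 l.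
Proof.
apply/funext => x; rewrite /tilt subKr [P1 x `^ l * _]mulrC.
by congr (_ / _); apply: eq_bigr => y _; rewrite mulrC.
Qed.

Lemma Qset0C (R : realType) (X : finType) (P0 P1 : X -> R) (g : R) :
  Qset0 P1 P0 (- g) = Qset1 P0 P1 g.
Proof.
by apply/seteqP; split=> Q [dQ H]; split=> //; move: H; rewrite (llrC _ _ P0 P1) lerN2.
Qed.

Theorem theorem3 (R : realType) (X : finType)
  (P0h P1h : X -> R) (d : (X -> R) -> (X -> R) -> \bar R) (alpha g l : R) :
  is_dist P0h -> is_dist P1h -> full_support P0h -> full_support P1h ->
  admissible_div d alpha ->
  - relent P0h P1h <= g -> g <= relent P1h P0h ->
  0 <= l <= 1 ->
  llr P0h P1h (tilt P0h P1h l) = g ->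
  sqrt_expansion (worst_exp d P0h (Qset0 P0h P1h g))
    (relent (tilt P0h P1h l) P0h)
    (2 / alpha * var_under P0h (fun x => tilt P0h P1h l x / P0h x))
  /\
  sqrt_expansion (worst_exp d P1h (Qset1 P0h P1h g))
    (relent (tilt P0h P1h l) P1h)
    (2 / alpha * var_under P1h (fun x => tilt P0h P1h l x / P1h x)).
Proof.
move=> dP0 dP1 P0_gt0 P1_gt0 dadm _ _ /andP[l0 l1] lg; split.
  have [a0 dQ] := admissible_chi_square _ _ _ _ _ dadm dP0 P0_gt0.
  exact: worst_exp_expansion.
have [a0 dQ] := admissible_chi_square _ _ _ _ _ dadm dP1 P1_gt0.
(* Reads hypothesis 1 as hypothesis 0 for the swapped pair, with threshold - g and parameter 1 -
   l. *)
rewrite -tiltC -Qset0C; apply: worst_exp_expansion => //.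
  by rewrite subr_ge0.
by rewrite tiltC llrC lg.
Qed.
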